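(* Let $t$ be a quantum seed and $\mathcal S=\{S_g\mid g\in M^\circ(t)\}$ an $M^\circ(t)$-pointed subset of $\widehat{\mathcal{LP}}(t)$ (i.e. $S_g$ is $g$-pointed for each $g$). For any $g\in M^\circ(t)$, the triangular function $\mathbf L_g$ with respect to $\mathcal S$ exists; that is, there is a $g$-pointed, bar-invariant element $\mathbf L_g\in\widehat{\mathcal{LP}}(t)$ whose $\prec_t$-decomposition in terms of $\mathcal S$ is $(\prec_t,\mathbf m)$-unitriangular.
   Context: $\Bbbk=\mathbb Z[q^{\pm1/2}]$, $v=q^{1/2}$, $\mathbf m=v^{-1}\mathbb Z[v^{-1}]$, $\mathbb N=\{0,1,\dots\}$. $I=I_{uf}\sqcup I_f$ is a finite set. A quantum seed $t$ has an integer matrix $\tilde B(t)=(b_{ij})_{i\in I,j\in I_{uf}}$ of full rank $|I_{uf}|$ with skew-symmetrizable $I_{uf}\times I_{uf}$ part, and a skew-symmetric integer matrix $\Lambda(t)=(\Lambda_{ij})_{i,j\in I}$ with $\tilde B^T\Lambda=(D'\ 0)$, $D'$ diagonal with positive integer entries. $M^\circ(t)=\bigoplus_{i\in I}\mathbb Zf_i\cong\mathbb Z^I$, $\lambda(f_i,f_j)=\Lambda_{ij}$. $\mathcal{LP}(t)=\bigoplus_{m\in M^\circ(t)}\Bbbk X^m$ with commutative product $X^m\cdot X^{m'}=X^{m+m'}$ and twisted product $X^m*X^{m'}=v^{\lambda(m,m')}X^{m+m'}$. $Y^n=X^{\tilde B(t)n}$, $Y_k=Y^{e_k}$. $\widehat{\mathcal{LP}}(t)=\mathcal{LP}(t)\otimes_{\Bbbk[Y_k]_{k\in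 I_{uf}}}\widehat{\Bbbk[Y_k]_{k\in I_{uf}}}$ is the formal completion, the hat being completion at the ideal generated by the $Y_k$ (formal Laurent series). The bar involution on $\widehat{\mathcal{LP}}(t)$ is the $\mathbb Z$-linear anti-automorphism $vX^m\mapsto v^{-1}X^m$. Dominance order: $m'\preceq_tm$ iff $m'=m+\tilde B(t)n$ for some $n\in\mathbb N^{I_{uf}}$. An element is $g$-pointed if it has the form $X^g\cdot(1+\sum_{0\neq n\in\mathbb N^{I_{uf}}}c_nY^n)$, $c_n\in\Bbbk$. Every $Z\in\widehat{\mathcal{LP}}(t)$ has a unique decomposition $Z=\sum_{g\in M^\circ(t)}\alpha_t(Z)(g)S_g$ with $\alpha_t(Z)(g)\in\Bbbk$ (possibly infinite, well defined in $\widehat{\mathcal{LP}}(t)$) such that $\{g\mid\alpha_t(Z)(g)\ne0\}$ has finitely many $\prec_t$-maximal elements, called the $\prec_t$-decomposition in terms of $\mathcal S$. A formal sum $\sum b_mS_m$ is $(\prec_t,\mathbf m)$-unitriangular if $\{m\mid b_m\ne0\}$ has a unique $\prec_t$-maximal element $g$, $b_g=1$, and $b_m\in\mathbf m$ for all $m\neq g$. *)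

(* Defs.v *)
From HB Require Import structures.
From mathcomp Require Import all_boot all_order all_algebra finmap.
From mathcomp.multinomials Require Import monalg.
From mathcomp Require Import all_classical.

Set Implicit Arguments.
Unset Strict Implicit.
Unset Printing Implicit Defensive.

Import Order.TTheory GRing.Theory Num.Theory.

Local Open Scope classical_set_scope.
Local Open Scope ring_scope.

(* The ring Z[v, v^-1], where v = q^(1/2). A Laurent polynomial is the finitely
   supported family of its coefficients: [c@_i] is the coefficient of v^i in c,
   and [<< z *g i >>] is z v^i. The ring structure of [malg] cannot be used,
   since it requires a monoid of exponents without nontrivial units. *)
Definition laurent : Type := {malg int[int]}.

HB.instance Definition _ := Choice.copy laurent {malg int[int]}.
HB.instance Definition _ := GRing.Zmodule.copy laurent {malg int[int]}.

Lemma laurent_coefB (c d : laurent) (i : int) : (c - d)@_i = c@_i - d@_i.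
Proof. exact: mcoeffB. Qed.

Definition vpow (i : int) : laurent := << i >>.

HB.lock Definition laurent_mul (c d : laurent) : laurent :=
  \sum_(i <- msupp c) \sum_(j <- msupp d) << c@_i * d@_j *g i + j >>.

Lemma laurent_mulw (A B : {fset int}) (c d : laurent) :
  (msupp c `<=` A)%fset -> (msupp d `<=` B)%fset ->
  laurent_mul c d = \sum_(i <- A) \sum_(j <- B) << c@_i * d@_j *g i + j >>.
Proof.
move=> cA dB; rewrite laurent_mul.unlock (big_fset_incl _ cA) /=.
  apply: eq_bigr => i _; apply: big_fset_incl => // j _ /mcoeff_outdom ->.
  by rewrite mulr0 monalgU0.
move=> i _ /mcoeff_outdom ci.
by rewrite big1 // => j _; rewrite ci mul0r monalgU0.
Qed.

Lemma laurent_mulC : commutative laurent_mul.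
Proof.
move=> c d; rewrite laurent_mul.unlock exchange_big /=.
by apply: eq_bigr => j _; apply: eq_bigr => i _; rewrite mulrC addrC.
Qed.

Lemma laurent_mulDl : left_distributive laurent_mul +%R.
Proof.
move=> c c' d.
rewrite [in RHS](laurent_mulw (fsubsetUl _ (msupp c')) (fsubset_refl _)).
rewrite [in RHS](laurent_mulw (fsubsetUr (msupp c) _) (fsubset_refl _)).
rewrite (laurent_mulw (msuppD_le _ _) (fsubset_refl _)) -big_split /=.
apply: eq_bigr => i _; rewrite -big_split /=; apply: eq_bigr => j _.
by rewrite mcoeffD mulrDl monalgUD.
Qed.

Lemma laurent_mul0l : left_zero 0 laurent_mul.
Proof. by move=> c; rewrite laurent_mul.unlock msupp0 big_seq_fset0. Qed.

Lemma laurent_mulUU (x y i j : int) :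
  laurent_mul << x *g i >> << y *g j >> = << x * y *g i + j >>.
Proof.
by rewrite (laurent_mulw msuppU_le msuppU_le) !big_seq_fset1 !mcoeffUU.
Qed.

Lemma laurent_mulDr : right_distributive laurent_mul +%R.
Proof. by move=> c d d'; rewrite !(laurent_mulC c) laurent_mulDl. Qed.

Lemma laurent_mul0r : right_zero 0 laurent_mul.
Proof. by move=> c; rewrite laurent_mulC laurent_mul0l. Qed.

Lemma laurent_ind (P : laurent -> Prop) :
  P 0 -> (forall c d, P c -> P d -> P (c + d)) ->
  (forall x i, P << x *g i >>) -> forall c, P c.
Proof. by move=> P0 PD PU c; rewrite [c]monalgE; apply: big_ind. Qed.

Lemma laurent_mulA : associative laurent_mul.
Proof.
move=> c d e; elim/laurent_ind: c => [|c c' IH IH'|x i].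
- by rewrite !laurent_mul0l.
- by rewrite !laurent_mulDl IH IH'.
elim/laurent_ind: d => [|d d' IH IH'|y j].
- by rewrite !(laurent_mul0l, laurent_mul0r).
- by rewrite !(laurent_mulDl, laurent_mulDr) IH IH'.
elim/laurent_ind: e => [|e e' IH IH'|z k].
- by rewrite !laurent_mul0r.
- by rewrite !laurent_mulDr IH IH'.
by rewrite !laurent_mulUU mulrA addrA.
Qed.

Lemma laurent_mul1 : left_id (vpow 0) laurent_mul.
Proof.
elim/laurent_ind => [|c d IH IH'|x i]; first exact: laurent_mul0r.
  by rewrite laurent_mulDr IH IH'.
by rewrite laurent_mulUU mul1r add0r.
Qed.

Lemma vpow0_neq0 : vpow 0 != 0.
Proof. by rewrite monalgU_eq0. Qed.

HB.instance Definition _ := GRing.Zmodule_isComNzRing.Build laurent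
  laurent_mulA laurent_mulC laurent_mul1 laurent_mulDl vpow0_neq0.

Lemma vpow0 : vpow 0 = 1.
Proof. by []. Qed.

Lemma vpowD (i j : int) : vpow (i + j) = vpow i * vpow j.
Proof. by rewrite [RHS]laurent_mulUU mulr1. Qed.

Definition laurent_bar (c : laurent) : laurent :=
  \sum_(i <- msupp c) << c@_i *g - i >>.

Lemma laurent_barE (c : laurent) (i : int) : (laurent_bar c)@_i = c@_(- i).
Proof.
rewrite /laurent_bar [in RHS](monalgE c) !raddf_sum /=.
by apply: eq_bigr => j _; rewrite !mcoeffU eqr_oppLR.
Qed.

Lemma laurent_barU (x i : int) : laurent_bar << x *g i >> = << x *g - i >>.
Proof.
by apply/malgP => j; rewrite laurent_barE !mcoeffU -eqr_oppLR.
Qed.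

Lemma laurent_bar_vpow (i : int) : laurent_bar (vpow i) = vpow (- i).
Proof. exact: laurent_barU. Qed.

Lemma laurent_barK : involutive laurent_bar.
Proof. by move=> c; apply/malgP => i; rewrite !laurent_barE opprK. Qed.

Lemma laurent_bar_is_zmod_morphism : zmod_morphism laurent_bar.
Proof.
move=> c d; apply/malgP => i; rewrite laurent_barE.
by rewrite !laurent_coefB !laurent_barE.
Qed.

HB.instance Definition _ := GRing.isZmodMorphism.Build laurent laurent
  laurent_bar laurent_bar_is_zmod_morphism.

Lemma laurent_bar_is_monoid_morphism : monoid_morphism laurent_bar.
Proof.
split=> [|c d]; first by rewrite -vpow0 laurent_barU oppr0.
elim/laurent_ind: c => [|c c' IH IH'|x i].
- by rewrite mul0r raddf0 mul0r.
- by rewrite mulrDl !raddfD /= IH IH' mulrDl.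
elim/laurent_ind: d => [|d d' IH IH'|y j].
- by rewrite mulr0 raddf0 mulr0.
- by rewrite mulrDr !raddfD /= IH IH' mulrDr.
rewrite [_ * _ in LHS]laurent_mulUU !laurent_barU [RHS]laurent_mulUU.
by rewrite opprD.
Qed.

HB.instance Definition _ := GRing.isMonoidMorphism.Build laurent laurent
  laurent_bar laurent_bar_is_monoid_morphism.

(* The subgroup v^-1 Z[v^-1]. *)
Definition in_m (c : laurent) : Prop := forall i : int, 0 <= i -> c@_i = 0.

(* The index sets are I_uf = {0, .., n-1} and I_f = {n, .., n+p-1}, so that
   [usubmx B] is the I_uf x I_uf part of B. *)
Record quantum_seed (n p : nat) := QuantumSeed {
  seedB : 'M[int]_(n + p, n);
  seedL : 'M[int]_(n + p);
  seedB_full_rank : \rank (map_mx intr seedB : 'M[rat]_(n + p, n)) = n;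
  seedB_skew_symmetrizable : exists d : 'rV[int]_n,
    (forall i, 0 < d 0 i) /\
    (diag_mx d *m usubmx seedB)^T = - (diag_mx d *m usubmx seedB);
  seedL_skew_symmetric : seedL^T = - seedL;
  seed_compatible : exists d : 'rV[int]_n,
    (forall i, 0 < d 0 i) /\ seedB^T *m seedL = row_mx (diag_mx d) 0
}.

(* The degree of Y^u, for u in N^I_uf. *)
Definition Ydeg n p (t : quantum_seed n p) (u : 'cV[nat]_n) : 'cV[int]_(n + p) :=
  seedB t *m map_mx Posz u.

Definition lambda n p (t : quantum_seed n p) (m m' : 'cV[int]_(n + p)) : int :=
  (m^T *m seedL t *m m') 0 0.

Definition dom_le n p (t : quantum_seed n p) (m' m : 'cV[int]_(n + p)) : Prop :=
  exists u : 'cV[nat]_n, m' = m + Ydeg t u.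

Definition dom_lt n p (t : quantum_seed n p) (m' m : 'cV[int]_(n + p)) : Prop :=
  dom_le t m' m /\ m' <> m.

Lemma dom_le_refl n p (t : quantum_seed n p) m : dom_le t m m.
Proof.
exists (const_mx 0%N); rewrite /Ydeg map_const_mx.
by rewrite (_ : const_mx _ = 0) ?mulmx0 ?addr0.
Qed.

Lemma YdegD n p (t : quantum_seed n p) u v :
  Ydeg t (u + v) = Ydeg t u + Ydeg t v.
Proof.
by rewrite /Ydeg -mulmxDr; congr (_ *m _); apply/matrixP => i j; rewrite !mxE.
Qed.

Lemma dom_leD n p (t : quantum_seed n p) a b m m' :
  dom_le t a m -> dom_le t b m' -> dom_le t (a + b) (m + m').
Proof. by move=> [u ->] [v ->]; exists (u + v); rewrite YdegD addrACA. Qed.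

Lemma Ydeg_inj n p (t : quantum_seed n p) : injective (Ydeg t).
Proof.
move=> u v /(congr1 (map_mx (intr : int -> rat))); rewrite !map_mxM.
have free : row_free (map_mx intr (seedB t) : 'M[rat]_(n + p, n))^T.
  by rewrite /row_free mxrank_tr seedB_full_rank.
move/(congr1 trmx); rewrite !trmx_mul => /(row_free_inj free).
move/trmx_inj/matrixP => uv; apply/matrixP => i j.
by have := uv i j; rewrite !mxE => /intr_inj [].
Qed.

(* Since B has full rank, LP(t) is a direct sum of copies of k[Y_k, Y_k^-1],
   indexed by the cosets of B Z^I_uf. Hence its completion is the set of the
   formal Laurent series Z = \sum_m Z_m X^m whose support is covered by finitely
   many cones g + B N^I_uf. *)
Record hatLP n p (t : quantum_seed n p) := HatLP {
  coefLP :> 'cV[int]_(n + p) -> laurent;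
  coefLP_supp : exists s : seq 'cV[int]_(n + p),
    forall m, coefLP m != 0 -> exists2 g, g \in s & dom_le t m g
}.

Lemma hatLP_ext n p (t : quantum_seed n p) (Z W : hatLP t) :
  (forall m, Z m = W m) -> Z = W.
Proof.
case: Z W => [Z ZP] [W WP] /= /funext ZW; case: _ / ZW in WP *.
by congr HatLP; exact: Prop_irrelevance.
Qed.

Lemma Xmon_supp n p (t : quantum_seed n p) (g : 'cV[int]_(n + p)) :
  exists s : seq 'cV[int]_(n + p), forall m, (m == g)%:R != 0 :> laurent ->
    exists2 h, h \in s & dom_le t m h.
Proof.
exists [:: g] => m; have [->|] := eqVneq m g; last by rewrite eqxx.
by exists g; rewrite ?mem_head //; exact: dom_le_refl.
Qed.

Definition Xmon n p (t : quantum_seed n p) (g : 'cV[int]_(n + p)) : hatLP t :=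
  HatLP (Xmon_supp t g).

(* Finitely supported sums [\sum_(i \in A)] are 0 when the support is infinite;
   this does not happen in the sums below. The map u |-> B u is injective, so
   the next sum has at most one term. In the products, if Z and W are supported
   in g + B N^I_uf and h + B N^I_uf, the terms at m are indexed by those a with
   a - g and m - h - a in B N^I_uf, and there are finitely many of them. *)
Lemma Yseries_supp n p (t : quantum_seed n p) (c : 'cV[nat]_n -> laurent) :
  exists s : seq 'cV[int]_(n + p), forall m,
    \sum_(u \in [set u | Ydeg t u = m]) c u != 0 ->
    exists2 g, g \in s & dom_le t m g.
Proof.
exists [:: 0] => m cm; exists 0; rewrite ?mem_head //.
apply: contrapT => m0; case/eqP: cm; apply: fsbig1 => u /= um.
by case: m0; exists u; rewrite add0r.
Qed.

Definition Yseries n p (t : quantum_seed n p) (c : 'cV[nat]_n -> laurent) :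
  hatLP t := HatLP (Yseries_supp t c).

Lemma mulLP_supp n p (t : quantum_seed n p) (Z W : hatLP t)
    (e : 'cV[int]_(n + p) -> 'cV[int]_(n + p) -> laurent) :
  exists s : seq 'cV[int]_(n + p), forall m,
    \sum_(a \in setT) e a (m - a) * (Z a * W (m - a)) != 0 ->
    exists2 g, g \in s & dom_le t m g.
Proof.
have [r Zr] := coefLP_supp Z; have [s Ws] := coefLP_supp W.
exists [seq g + h | g <- r, h <- s] => m.
move=> ZW; apply: contrapT => nm; case/eqP: ZW; apply: fsbig1 => a _.
have [->|/Zr[g gr ag]] := eqVneq (Z a) 0; first by rewrite mul0r mulr0.
have [->|/Ws[h hs ah]] := eqVneq (W (m - a)) 0; first by rewrite !mulr0.
case: nm; exists (g + h); first exact: allpairs_f.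
by rewrite -(subrK a m) addrC; exact: dom_leD.
Qed.

(* The product with X^m X^m' = e m m' X^(m + m'). *)
Definition mulLP_by n p (t : quantum_seed n p)
    (e : 'cV[int]_(n + p) -> 'cV[int]_(n + p) -> laurent) (Z W : hatLP t) :
  hatLP t := HatLP (mulLP_supp Z W e).

Definition mulLP n p (t : quantum_seed n p) : hatLP t -> hatLP t -> hatLP t :=
  mulLP_by (fun _ _ => 1).

Definition twistLP n p (t : quantum_seed n p) : hatLP t -> hatLP t -> hatLP t :=
  mulLP_by (fun m m' => vpow (lambda t m m')).

Lemma barLP_supp n p (t : quantum_seed n p) (Z : hatLP t) :
  exists s : seq 'cV[int]_(n + p), forall m, laurent_bar (Z m) != 0 ->
    exists2 g, g \in s & dom_le t m g.
Proof.
have [s Zs] := coefLP_supp Z; exists s => m Zm; apply: Zs.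
by apply: contra_neq Zm => ->; rewrite raddf0.
Qed.

Definition barLP n p (t : quantum_seed n p) (Z : hatLP t) : hatLP t :=
  HatLP (barLP_supp Z).

Lemma lambda_skew n p (t : quantum_seed n p) m m' :
  lambda t m m' = - lambda t m' m.
Proof.
rewrite /lambda -[in LHS](trmxK (_ *m m')) mxE !trmx_mul trmxK.
by rewrite seedL_skew_symmetric mulNmx mulmxN mulmxA mxE.
Qed.

Lemma laurent_bar_fsum (I : choiceType) (A : set I) (F : I -> laurent) :
  laurent_bar (\sum_(i \in A) F i) = \sum_(i \in A) laurent_bar (F i).
Proof.
rewrite raddf_sum; congr (\big[_/_]_(i <- _) _); rewrite /finite_support !unlock.
congr fset_set; apply/seteqP.
split=> i /= [Ai Fi]; split=> //; apply: contra_not Fi => F0.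
  by rewrite -[F i]laurent_barK F0 raddf0.
by rewrite F0 raddf0.
Qed.

Lemma barLP_anti n p (t : quantum_seed n p) (Z W : hatLP t) :
  barLP (twistLP Z W) = twistLP (barLP W) (barLP Z).
Proof.
apply: hatLP_ext => m /=; rewrite laurent_bar_fsum.
rewrite (reindex_fsbigT (fun a => m - a)); last first.
  by exists (fun a => m - a) => a; rewrite opprB addrC subrK.
apply: eq_fsbigr => a _; rewrite !rmorphM /= subKr.
by rewrite laurent_bar_vpow (lambda_skew t a) [laurent_bar (Z _) * _]mulrC.
Qed.

Definition pointed n p (t : quantum_seed n p) (g : 'cV[int]_(n + p))
    (Z : hatLP t) : Prop :=
  exists c : 'cV[nat]_n -> laurent,
    c (const_mx 0%N) = 1 /\ Z = mulLP (Xmon t g) (Yseries t c).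

Lemma pointedP n p (t : quantum_seed n p) (g : 'cV[int]_(n + p)) (Z : hatLP t) :
  pointed g Z <-> Z g = 1 /\ forall m, Z m != 0 -> dom_le t m g.
Proof.
have ZE c m : mulLP (Xmon t g) (Yseries t c) m = Yseries t c (m - g).
  rewrite /= -(fsbig_widen [set g] setT) //=; last first.
    by move=> a [_ /= /eqP ag]; rewrite (negbTE ag) mul0r mulr0.
  by rewrite fsbig_set1 eqxx !mul1r.
have YE c u : Yseries t c (Ydeg t u) = c u.
  rewrite /= (_ : [set _ | _] = [set u]) ?fsbig_set1 //.
  by apply/seteqP; split=> v /= => [/Ydeg_inj|->].
have Y0 : Ydeg t (const_mx 0%N) = 0.
  by rewrite /Ydeg map_const_mx (_ : const_mx _ = 0) ?mulmx0.
split=> [[c [c0 ->]]|[Zg ZP]].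
  split=> [|m]; first by rewrite ZE subrr -Y0 YE.
  rewrite ZE => cm; apply: contrapT => mg; case/eqP: cm.
  apply: fsbig1 => u /= um; case: mg; exists u.
  by rewrite um addrC subrK.
exists (fun u => Z (g + Ydeg t u)); rewrite Y0 addr0; split=> //.
apply: hatLP_ext => m; rewrite ZE.
have [[u ->]|mg] := pselect (dom_le t m g); first by rewrite addrAC subrr add0r YE.
have [->|/ZP //] := eqVneq (Z m) 0.
apply/esym/fsbig1 => u /= um; case: mg; exists u.
by rewrite um addrC subrK.
Qed.

Lemma scaleLP_supp n p (t : quantum_seed n p) (a : laurent) (Z : hatLP t) :
  exists s : seq 'cV[int]_(n + p), forall m, a * Z m != 0 ->
    exists2 g, g \in s & dom_le t m g.
Proof.
have [s Zs] := coefLP_supp Z; exists s => m aZm; apply: Zs.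
by apply: contra_neq aZm => ->; rewrite mulr0.
Qed.

Definition scaleLP n p (t : quantum_seed n p) (a : laurent) (Z : hatLP t) :
  hatLP t := HatLP (scaleLP_supp a Z).

(* The sum of the F g is taken coefficientwise, and each coefficient has to be a
   finite sum. For a family supported in finitely many common cones, this is
   convergence for the topology given by the ideal generated by the Y_k. *)
Definition is_sumLP n p (t : quantum_seed n p) (F : 'cV[int]_(n + p) -> hatLP t)
    (Z : hatLP t) : Prop :=
  forall m, finite_set [set g | F g m != 0] /\ Z m = \sum_(g \in setT) F g m.

Definition dom_maximal n p (t : quantum_seed n p) (A : set 'cV[int]_(n + p)) :
    set 'cV[int]_(n + p) :=
  [set g | A g /\ forall h, A h -> ~ dom_lt t g h].

Definition coef_supp n p (b : 'cV[int]_(n + p) -> laurent) :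
    set 'cV[int]_(n + p) := [set m | b m != 0].

(* Each element of the support is required to lie below one of the finitely many
   maximal elements. Otherwise decompositions would not be unique: if n = 1, y is
   the degree of Y_1 and S_g = X^g (1 - Y_1) for all g, then X^y would be both
   \sum_(k >= 1) S_(k y) and - \sum_(k <= 0) S_(k y), where the support of the
   latter has no maximal element. *)
Definition dom_decomposition n p (t : quantum_seed n p)
    (S : 'cV[int]_(n + p) -> hatLP t) (Z : hatLP t)
    (b : 'cV[int]_(n + p) -> laurent) : Prop :=
  [/\ finite_set (dom_maximal t (coef_supp b)),
      forall m, coef_supp b m ->
        exists2 g, dom_maximal t (coef_supp b) g & dom_le t m g
    & is_sumLP (fun g => scaleLP (b g) (S g)) Z].

Definition unitriangular n p (t : quantum_seed n p)
    (b : 'cV[int]_(n + p) -> laurent) : Prop :=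
  exists g, [/\ unique (dom_maximal t (coef_supp b)) g, b g = 1
              & forall m, m <> g -> in_m (b m)].

(* Main.v *)
(* The bar involution acts on each coefficient separately. Writing the unknown
   L = \sum_h b_h S_h, the coefficient of L at X^m is b_m + r_m, where r_m only
   involves the b_h with m < h <= g, and there are finitely many such h. Every
   Laurent polynomial r becomes bar-invariant after adding a (unique) element of
   v^-1 Z[v^-1], so the b_m can be determined recursively from b_g = 1. *)
Require Import Defs.
From HB Require Import structures.
From mathcomp Require Import all_boot all_order all_algebra finmap.
From mathcomp.multinomials Require Import monalg.
From mathcomp Require Import all_classical.

Set Implicit Arguments.
Unset Strict Implicit.
Unset Printing Implicit Defensive.

Import Order.TTheory GRing.Theory Num.Theory.

Local Open Scope classical_set_scope.
Local Open Scope ring_scope.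

(** Letting the recursion step take a total function allows it to be a sum over a set of indices. A
    function known only on the predecessors of [x] is extended by [u0]; by the congruence hypothesis
    on [F], this default never affects the result. *)
Lemma wf_recursion (T U : Type) (R : T -> T -> Prop) (F : T -> (T -> U) -> U) :
    well_founded R -> inhabited U ->
    (forall x f f', (forall y, R y x -> f y = f' y) -> F x f = F x f') ->
  exists f : T -> U, forall x, f x = F x f.
Proof.
move=> Rwf [u0] Fext.
pose ext x (f : forall y, R y x -> U) y :=
  if pselect (R y x) is left yx then f y yx else u0.
exists (Fix Rwf (fun=> U) (fun x f => F x (ext x f))) => x.
rewrite Fix_eq => [|y f f' ff']; apply: Fext => z zx; rewrite /ext.
  by case: pselect.
by case: pselect.
Qed.

Definition laurent_neg (c : laurent) : laurent :=
  \sum_(i <- msupp c | i < 0) << c@_i *g i >>.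

Lemma laurent_negE (c : laurent) (i : int) :
  (laurent_neg c)@_i = c@_i *+ (i < 0)%R.
Proof.
rewrite /laurent_neg [c in RHS]monalgE !raddf_sum -sumrMnl big_mkcond /=.
apply: eq_bigr => j _; rewrite !mcoeffU.
have [<-|ij] := eqVneq j i; first by case: (j < 0); rewrite ?mcoeffU ?eqxx.
by case: (j < 0); rewrite ?mcoeffU ?mcoeff0 ?(negPf ij) mul0rn.
Qed.

Definition bar_correction (r : laurent) : laurent :=
  laurent_neg (laurent_bar r - r).

Lemma bar_correction0 : bar_correction 0 = 0.
Proof.
by apply/malgP => i; rewrite laurent_negE raddf0 subrr mcoeff0 mul0rn.
Qed.

Lemma bar_correction_in_m r : in_m (bar_correction r).
Proof. by move=> i i0; rewrite laurent_negE ltNge i0. Qed.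

(** The difference d = bar(r) - r satisfies bar(d) = -d, so its constant term is 0 and d = x -
    bar(x), where x is its part with negative exponents. Hence x + r = bar(x) + bar(r). *)
Lemma bar_correctionP r :
  laurent_bar (bar_correction r + r) = bar_correction r + r.
Proof.
apply/malgP => i; rewrite laurent_barE !mcoeffD !laurent_negE.
rewrite !laurent_coefB !laurent_barE opprK oppr_lt0.
by case: (ltgtP i 0) => [_|_|->]; rewrite ?mulr1n ?mulr0n ?oppr0 ?add0r ?subrK.
Qed.

Section DominanceOrder.
Variables (n p : nat) (t : quantum_seed n p).
Implicit Types (g h m : 'cV[int]_(n + p)) (u v : 'cV[nat]_n).

Lemma dom_le_trans h m g : dom_le t m h -> dom_le t h g -> dom_le t m g.
Proof. by move=> [u ->] [v ->]; exists (v + u); rewrite YdegD addrA. Qed.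

Lemma Ydeg0 : Ydeg t 0 = 0.
Proof. by apply: (addrI (Ydeg t 0)); rewrite -YdegD !addr0. Qed.

Lemma Ydeg_eq0 u : Ydeg t u = 0 -> u = 0.
Proof. by rewrite -Ydeg0 => /Ydeg_inj. Qed.

(** By injectivity of [Ydeg], going down by u and then by v returns to the start only if u + v = 0,
    and entries in N cannot cancel. *)
Lemma dom_le_anti m h : dom_le t m h -> dom_le t h m -> m = h.
Proof.
move=> [u ->] [v /eqP]; rewrite -addrA -YdegD -[X in X == _]addr0.
rewrite (inj_eq (addrI h)) eq_sym => /eqP/Ydeg_eq0/colP uv0.
suff -> : u = 0 by rewrite Ydeg0 addr0.
apply/colP => i; move/eqP: (uv0 i); rewrite !mxE.
by rewrite addn_eq0 => /andP[/eqP].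
Qed.

(** If m = g + B u, then each h in the interval is g + B w with w <= u entrywise, which leaves
    finitely many w. *)
Lemma finite_dom_interval g m :
  finite_set [set h | dom_le t m h /\ dom_le t h g].
Proof.
have [[u ->]|mg] := pselect (dom_le t m g); last first.
  rewrite (_ : [set _ | _] = set0) // -subset0 => h /= [mh].
  by move/(dom_le_trans mh).
(* All entries of w are at most the largest entry of u, so w comes from a matrix over the finite
   type ['I_k]. *)
pose k := (\max_i u i 0%R).+1.
apply: (@sub_finite_set _ _
  ((fun w : 'cV['I_k]_n => g + Ydeg t (map_mx (@nat_of_ord k) w)) @` setT));
  last exact: finite_image.
move=> h /= [[v E] [w hE]]; rewrite {h}hE in E *.
have {}E : u = w + v.
  by apply: (@Ydeg_inj _ _ t); apply: (addrI g); rewrite E YdegD addrA.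
have wk i : (w i 0%R < k)%N.
  rewrite ltnS; apply: leq_trans (leq_bigmax i).
  by rewrite E mxE; exact: leq_addr.
exists (\col_i Ordinal (wk i)) => //; congr (_ + Ydeg _ _).
by apply/colP => i; rewrite !mxE.
Qed.

(** The recursion at [m] calls larger elements [h]. Ascending chains can be infinite in the
    dominance order; the bound [g] cuts them off. *)
Definition dom_between g h m : Prop := dom_lt t m h /\ dom_le t h g.

(** For elements g + B u, the sum of the entries of u drops strictly at each step up towards g. *)
Lemma dom_between_wf g : well_founded (dom_between g).
Proof.
suff A k u : (\sum_i u i 0%R < k)%N -> Acc (dom_between g) (g + Ydeg t u).
  (* An arbitrary [m] need not lie below [g], but all its predecessors do. *)
  by move=> m; constructor => _ [_ [u ->]]; exact: (A _.+1 u (ltnSn _)).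
elim: k u => [u|k IH u uk]; first by rewrite ltn0.
constructor => h [[[v E] ne] [w hE]]; rewrite {h}hE in E ne *.
apply: IH; rewrite ltnS in uk; apply: leq_trans uk.
have {}E : u = w + v.
  by apply: (@Ydeg_inj _ _ t); apply: (addrI g); rewrite E YdegD addrA.
have -> : (\sum_i u i 0%R = \sum_i w i 0%R + \sum_i v i 0%R)%N.
  by rewrite -big_split E; apply: eq_bigr => i _; rewrite mxE.
(* If v were 0, then h would equal g + B u, against strictness. *)
rewrite -[X in (X < _)%N]addn0 ltn_add2l lt0n sum_nat_eq0.
apply/negP => /forallP v0; apply: ne; rewrite E.
rewrite (_ : v = 0) ?addr0 //; apply/colP => i.
by rewrite mxE; exact/eqP/v0.
Qed.

End DominanceOrder.

Lemma pointed_coef n p (t : quantum_seed n p) g (Z : hatLP t) :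
  pointed g Z -> Z g = 1.
Proof. by case/pointedP. Qed.

Lemma pointed_dom_le n p (t : quantum_seed n p) g (Z : hatLP t) m :
  pointed g Z -> Z m != 0 -> dom_le t m g.
Proof. by case/pointedP=> _; exact. Qed.

Section PointedSums.
Variables (n p : nat) (t : quantum_seed n p).
Variable S : 'cV[int]_(n + p) -> hatLP t.
Hypothesis S_pointed : forall g, pointed g (S g).
Variables (g : 'cV[int]_(n + p)) (b : 'cV[int]_(n + p) -> laurent).
Hypothesis b_dom_le : forall h, b h != 0 -> dom_le t h g.
Implicit Types (h m : 'cV[int]_(n + p)).

Lemma pointed_term_interval m h :
  b h * S h m != 0 -> dom_le t m h /\ dom_le t h g.
Proof.
have [->|/b_dom_le hg] := eqVneq (b h) 0; first by rewrite mul0r eqxx.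
have [->|/(pointed_dom_le (S_pointed h)) mh] := eqVneq (S h m) 0; last by [].
by rewrite mulr0 eqxx.
Qed.

Lemma finite_pointed_terms m : finite_set [set h | b h * S h m != 0].
Proof.
apply: sub_finite_set (finite_dom_interval t g m) => h.
exact: pointed_term_interval.
Qed.

Lemma pointed_sum_supp : exists s : seq 'cV[int]_(n + p),
  forall m, \sum_(h \in setT) b h * S h m != 0 ->
  exists2 h, h \in s & dom_le t m h.
Proof.
exists [:: g] => m bSm; exists g; rewrite ?mem_head //.
apply: contrapT => nmg; case/eqP: bSm; apply: fsbig1 => h _.
apply/eqP; apply: contra_notT nmg => /pointed_term_interval[mh].
exact: dom_le_trans.
Qed.

Definition pointed_sum : hatLP t := HatLP pointed_sum_supp.

Lemma pointed_sumP : is_sumLP (fun h => scaleLP (b h) (S h)) pointed_sum.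
Proof. by move=> m; split; first exact: finite_pointed_terms. Qed.

Lemma pointed_sum_coef m : pointed_sum m =
  b m + \sum_(h \in [set h | dom_between t g h m]) b h * S h m.
Proof.
(* Nonzero terms have m <= h <= g. The index h = m is split off, where pointedness gives S_m the
   coefficient 1. *)
rewrite /= -(fsbig_widen (m |` [set h | dom_between t g h m]) setT) //=.
  rewrite fsbigU0.
  - by rewrite fsbig_set1 (pointed_coef (S_pointed m)) mulr1.
  - exact: finite_set1.
  - apply: sub_finite_set (finite_dom_interval t g m).
    by move=> h [[]].
  - by move=> h /= [-> [[_]]].
move=> h [_ /= nh]; apply/eqP; apply: contra_notT nh.
move=> /pointed_term_interval[mh hg].
have [->|/eqP hm] := eqVneq h m; [by left|right].
by split=> //; split=> // mh'; apply: hm.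
Qed.

Lemma dom_maximal_apex : b g != 0 -> dom_maximal t (coef_supp b) = [set g].
Proof.
move=> bg; apply/seteqP; split=> [h [/b_dom_le hg]|_ ->].
  move=> /(_ g bg) hmax; apply: contrapT => nhg; exact: hmax.
split=> // h /b_dom_le hg [gh]; apply; exact: dom_le_anti gh hg.
Qed.

End PointedSums.

Theorem theorem6p1p3 (n p : nat) (t : quantum_seed n p)
    (S : 'cV[int]_(n + p) -> hatLP t) (S_pointed : forall g, pointed g (S g))
    (g : 'cV[int]_(n + p)) :
  exists L : hatLP t,
    [/\ pointed g L, barLP L = L
      & exists b : 'cV[int]_(n + p) -> laurent,
          dom_decomposition S L b /\ unitriangular t b].
Proof.
pose rest m (b : 'cV[int]_(n + p) -> laurent) :=
  \sum_(h \in [set h | dom_between t g h m]) b h * S h m.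
(* The value 1 at [g] is imposed separately: no terms remain there, so the correction would be 0. *)
have [|m b b' bb'|b bE] := @wf_recursion _ laurent _
    (fun m b => if m == g then 1 else bar_correction (rest m b))
    (dom_between_wf t g).
- exact: (inhabits 0).
- case: ifP => // _; congr bar_correction.
  by apply: eq_fsbigr => h /set_mem /bb' ->.
have rest0 m : ~ dom_lt t m g -> rest m b = 0.
  move=> mg; rewrite /rest (_ : [set _ | _] = set0) ?fsbig_set0 //.
  rewrite -subset0 => h [[mh ne] hg]; apply: mg; split.
    exact: dom_le_trans mh hg.
  by move=> mg; rewrite mg in mh ne; exact: ne (dom_le_anti mh hg).
have bg : b g = 1 by rewrite bE eqxx.
(* The recursion defines b on all degrees. Outside the cone below g the remaining sum is empty, and
   the correction of 0 is 0. *)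
have b_dom_le h : b h != 0 -> dom_le t h g.
  move=> bh; apply: contrapT => hg; case/eqP: bh; rewrite bE.
  case: eqP => [hE|_]; first by case: hg; rewrite hE; exact: dom_le_refl.
  by rewrite rest0 ?bar_correction0 // => -[].
have bmax : dom_maximal t (coef_supp b) = [set g].
  by apply: dom_maximal_apex => //; rewrite bg oner_neq0.
pose L := pointed_sum S_pointed b_dom_le.
have LE m : L m = b m + rest m b.
  exact: pointed_sum_coef.
have barLE m : barLP L m = laurent_bar (L m) by [].
have Lg : L g = 1.
  by rewrite LE bg rest0 ?addr0 // => -[].
exists L; split.
- apply/pointedP; split=> // m; rewrite LE => bm; apply: contrapT => mg.
  case/eqP: bm; rewrite rest0 ?addr0 => [|[]//].
  by apply/eqP; apply: contra_notT mg; exact: b_dom_le.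
- apply: hatLP_ext => m; have [->|mg] := eqVneq m g.
    by rewrite barLE Lg rmorph1.
  by rewrite barLE LE bE (negPf mg) bar_correctionP.
exists b; split; first split.
- by rewrite bmax; exact: finite_set1.
- by move=> m /b_dom_le mg; exists g; rewrite ?bmax.
- exact: pointed_sumP.
exists g; rewrite bmax; split=> //; first by split=> // h ->.
move=> m /eqP mg.
by rewrite bE (negPf mg); exact: bar_correction_in_m.
Qed.
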